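(* Let $F\subset\mathbb{R}^2$ be an unbounded convex quadrilateral with two parallel sides. Then there exist $S\subset T\subset\mathbb{R}^2$, with $|S|=2$ and $|T|=4$, such that $V_T(S)=F$.
   Context: For a finite nonempty set $T\subset\mathbb{R}^n$ and a nonempty proper subset $S\subset T$, the multipoint (higher order) Voronoi cell is $$V_T(S):=\left\{x\in\mathbb{R}^n : \max_{s\in S}\|x-s\|\le\min_{t\in T\setminus S}\|x-t\|\right\},$$ where $\|\cdot\|$ is the Euclidean norm. An unbounded convex polygon is an unbounded intersection of finitely many closed halfplanes in $\mathbb{R}^2$ with nonempty interior; its sides are its one-dimensional faces and its vertices are its extreme points. An unbounded convex quadrilateral is an unbounded convex polygon with exactly four sides and three vertices (two bounded sides, which are segments, and two unbounded sides, which are rays). *)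

(* Defs.v *)
From mathcomp Require Import all_boot all_order all_algebra finmap.
From mathcomp Require Import all_classical all_reals all_analysis.

Set Implicit Arguments.
Unset Strict Implicit.
Unset Printing Implicit Defensive.

Import Order.TTheory GRing.Theory Num.Theory.
Import numFieldNormedType.Exports.

Local Open Scope classical_set_scope.
Local Open Scope ring_scope.

Definition dotp (R : realType) (n : nat) (x y : 'rV[R]_n) : R :=
  \sum_(i < n) x 0 i * y 0 i.

(* The library norm on 'rV[R]_n is the sup norm, hence this definition. *)
Definition enorm (R : realType) (n : nat) (x : 'rV[R]_n) : R :=
  Num.sqrt (dotp x x).

(* Max and min are taken in \bar R, where they have neutral elements; these
   play no role when S is a nonempty proper subset of T. *)
Definition voronoi_cell (R : realType) (n : nat) (T S : {fset 'rV[R]_n}) :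
    set 'rV[R]_n :=
  [set x | (\big[maxe/-oo]_(s <- S) (enorm (x - s))%:E
            <= \big[mine/+oo]_(t <- (T `\` S)%fset) (enorm (x - t))%:E)%E].

Definition closed_halfplane (R : realType) (a : 'rV[R]_2) (b : R) :
    set 'rV[R]_2 :=
  [set x | dotp a x <= b].

(* Interior and boundedness are the library's; they do not depend on the choice
   of a norm on the plane. *)
Definition unbounded_convex_polygon (R : realType) (F : set 'rV[R]_2) : Prop :=
  [/\ exists (k : nat) (a : 'I_k -> 'rV[R]_2) (b : 'I_k -> R),
        (forall i, a i != 0) /\
        F = \bigcap_(i in [set: 'I_k]) closed_halfplane (a i) (b i),
      interior F !=set0 &
      ~ bounded_set F].

Definition open_segment (R : realType) (x y : 'rV[R]_2) : set 'rV[R]_2 :=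
  [set (1 - t) *: x + t *: y | t in [set t : R | 0 < t < 1]].

Definition closed_segment (R : realType) (x y : 'rV[R]_2) : set 'rV[R]_2 :=
  [set (1 - t) *: x + t *: y | t in [set t : R | 0 <= t <= 1]].

Definition ray (R : realType) (p u : 'rV[R]_2) : set 'rV[R]_2 :=
  [set p + t *: u | t in [set t : R | 0 <= t]].

Definition straight_line (R : realType) (p u : 'rV[R]_2) : set 'rV[R]_2 :=
  [set p + t *: u | t in [set: R]].

Definition is_face (R : realType) (F G : set 'rV[R]_2) : Prop :=
  [/\ G `<=` F,
      convex_set (G : set (convex_lmodType 'rV[R]_2)) &
      forall x y, F x -> F y -> open_segment x y `&` G !=set0 -> G x /\ G y].

Definition one_dimensional (R : realType) (G : set 'rV[R]_2) : Prop :=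
  (exists p u, u != 0 /\ G `<=` straight_line p u) /\
  (exists x y, [/\ G x, G y & x != y]).

Definition sides (R : realType) (F : set 'rV[R]_2) : set (set 'rV[R]_2) :=
  [set G | is_face F G /\ one_dimensional G].

Definition vertices (R : realType) (F : set 'rV[R]_2) : set 'rV[R]_2 :=
  [set v | F v /\
     forall x y, F x -> F y -> open_segment x y v -> x = v /\ y = v].

Definition is_segment (R : realType) (G : set 'rV[R]_2) : Prop :=
  exists x y, x != y /\ G = closed_segment x y.

Definition is_ray (R : realType) (G : set 'rV[R]_2) : Prop :=
  exists p u, u != 0 /\ G = ray p u.

Definition unbounded_convex_quadrilateral (R : realType) (F : set 'rV[R]_2) :
    Prop :=
  [/\ unbounded_convex_polygon F,
      (sides F #= `I_4)%card,
      (vertices F #= `I_3)%card,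
      (sides F `&` bounded_set #= `I_2)%card /\
        sides F `&` bounded_set `<=` [set G | is_segment G] &
      (sides F `\` bounded_set #= `I_2)%card /\
        sides F `\` bounded_set `<=` [set G | is_ray G]].

Definition parallel (R : realType) (G H : set 'rV[R]_2) : Prop :=
  exists u, [/\ u != 0, exists p, G `<=` straight_line p u &
                exists q, H `<=` straight_line q u].

(* Main.v *)
(** Let [u] be a unit vector parallel to the two parallel sides, and use the
    coordinates [X = dotp (perp u)], [Y = dotp u]. A face contained in a vertical
    line is cut out by a supporting line, so [F] lies in a strip [g <= X <= h] and
    touches both of its boundary lines. Since [F] is unbounded and polyhedral, up
    to replacing [u] by [- u] every defining halfplane is vertical or of the form
    [Y >= l X] with [l] affine, hence [F] is the part of the strip above finitely
    many affine functions. When this family is irredundant, its members correspond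
    bijectively to the bounded sides, so there are exactly two of them, with
    different slopes, and their graphs cross strictly inside the strip. In
    particular the parallel sides are the two rays, and four sites can be written
    down explicitly. *)

Require Import Defs.
From mathcomp Require Import all_boot all_order all_algebra finmap.
From mathcomp Require Import all_classical all_reals all_analysis.
From mathcomp Require Import ring lra.

Set Implicit Arguments.
Unset Strict Implicit.
Unset Printing Implicit Defensive.

Import Order.TTheory GRing.Theory Num.Theory.
Import numFieldNormedType.Exports.

Local Open Scope classical_set_scope.
Local Open Scope ring_scope.

(** * Orthonormal coordinates attached to a unit vector [u] *)

Lemma dotp2E (R : realType) (x y : 'rV[R]_2) :
  dotp x y = x 0 0 * y 0 0 + x 0 1 * y 0 1.
Proof.
rewrite /dotp !big_ord_recl big_ord0 addr0.
by rewrite (_ : lift ord0 ord0 = 1) //; apply/val_inj.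
Qed.

Lemma dotpC (R : realType) (x y : 'rV[R]_2) : dotp x y = dotp y x.
Proof. by rewrite !dotp2E; ring. Qed.

Lemma dotpDr (R : realType) (a x y : 'rV[R]_2) :
  dotp a (x + y) = dotp a x + dotp a y.
Proof. by rewrite !dotp2E !mxE; ring. Qed.

Lemma dotpNr (R : realType) (a x : 'rV[R]_2) : dotp a (- x) = - dotp a x.
Proof. by rewrite !dotp2E !mxE; ring. Qed.

Lemma dotpZr (R : realType) (a x : 'rV[R]_2) (t : R) :
  dotp a (t *: x) = t * dotp a x.
Proof. by rewrite !dotp2E !mxE; ring. Qed.

Definition dotp_linr := (dotpDr, dotpNr, dotpZr).

Definition perp (R : realType) (u : 'rV[R]_2) : 'rV[R]_2 :=
  \row_j (if j == 0 then - u 0 1 else u 0 0).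

Definition frame_point (R : realType) (u : 'rV[R]_2) (a b : R) : 'rV[R]_2 :=
  a *: perp u + b *: u.

Lemma perp0 (R : realType) (u : 'rV[R]_2) : perp u 0 0 = - u 0 1.
Proof. by rewrite mxE eqxx. Qed.

Lemma perp1 (R : realType) (u : 'rV[R]_2) : perp u 0 1 = u 0 0.
Proof. by rewrite mxE. Qed.

Lemma perpN (R : realType) (u : 'rV[R]_2) : perp (- u) = - perp u.
Proof. by apply/rowP => i; rewrite !mxE; case: ifP. Qed.

Lemma dotp_perp (R : realType) (u : 'rV[R]_2) : dotp (perp u) u = 0.
Proof. by rewrite dotp2E perp0 perp1; ring. Qed.

Lemma dotp_perp2 (R : realType) (u : 'rV[R]_2) :
  dotp (perp u) (perp u) = dotp u u.
Proof. by rewrite !dotp2E perp0 perp1; ring. Qed.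

Lemma frame_pointX (R : realType) (u : 'rV[R]_2) (a b : R) :
  dotp u u = 1 -> dotp (perp u) (frame_point u a b) = a.
Proof. by move=> u1; rewrite !dotp_linr dotp_perp2 dotp_perp u1; ring. Qed.

Lemma frame_pointY (R : realType) (u : 'rV[R]_2) (a b : R) :
  dotp u u = 1 -> dotp u (frame_point u a b) = b.
Proof. by move=> u1; rewrite !dotp_linr (dotpC u (perp u)) dotp_perp u1; ring. Qed.

Lemma frame_pointK (R : realType) (u x : 'rV[R]_2) :
  dotp u u = 1 -> frame_point u (dotp (perp u) x) (dotp u x) = x.
Proof.
rewrite dotp2E => u1; apply/rowP => i.
have {i} [->|->] : i = 0 \/ i = 1.
  by case: i => [[|[|i]]] // Hi; [left|right]; exact/val_inj.
- rewrite /frame_point mxE [_ 0 0]mxE perp0 [_ 0 0]mxE !dotp2E perp0 perp1.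
  (* Multiplying by [1 = dotp u u] makes both sides homogeneous, so the claim becomes a polynomial
     identity. *)
  rewrite -[RHS]mulr1 -u1; ring.
- rewrite /frame_point mxE [_ 0 1]mxE perp1 [_ 0 1]mxE !dotp2E perp0 perp1.
  rewrite -[RHS]mulr1 -u1; ring.
Qed.

Lemma coord_inj (R : realType) (u x y : 'rV[R]_2) : dotp u u = 1 ->
  dotp (perp u) x = dotp (perp u) y -> dotp u x = dotp u y -> x = y.
Proof. by move=> u1 ex ey; rewrite -(frame_pointK x u1) ex ey frame_pointK. Qed.

Lemma dotp_coord (R : realType) (u a x : 'rV[R]_2) : dotp u u = 1 ->
  dotp a x = dotp a (perp u) * dotp (perp u) x + dotp a u * dotp u x.
Proof. by move=> u1; rewrite -{1}(frame_pointK x u1) !dotp_linr; ring. Qed.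

Lemma dotpxx_coord (R : realType) (u x : 'rV[R]_2) : dotp u u = 1 ->
  dotp x x = dotp (perp u) x ^+ 2 + dotp u x ^+ 2.
Proof.
by move=> u1; rewrite (dotp_coord _ _ u1) (dotpC x (perp u)) (dotpC x u); ring.
Qed.

Lemma bounded_coord (R : realType) (u : 'rV[R]_2) (A : set 'rV[R]_2) (M : R) :
  dotp u u = 1 ->
  (forall x, A x -> `|dotp (perp u) x| <= M /\ `|dotp u x| <= M) ->
  bounded_set A.
Proof.
move=> u1 bA; exists (M * `|perp u| + M * `|u|); split; first exact: num_real.
move=> N leN x Ax; apply: le_trans (ltW leN).
have [bX bY] := bA x Ax; rewrite -(frame_pointK x u1).
apply: le_trans (ler_normD _ _) _; rewrite !normrZ.
by apply: lerD; apply: ler_wpM2r.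
Qed.

Lemma bounded_dotp (R : realType) (u : 'rV[R]_2) (A : set 'rV[R]_2) :
  bounded_set A -> exists M, forall x, A x -> dotp u x <= M.
Proof.
move=> /pinfty_ex_gt0[M M0 bA]; exists (`|u 0 0| * M + `|u 0 1| * M) => x Ax.
have bx i : `|x 0 i| <= M.
  apply: le_trans (bA x Ax); rewrite [leRHS]/Num.norm /= mx_normrE.
  exact: (le_bigmax _ (fun ij => `|x ij.1 ij.2|) (0, i)).
rewrite dotp2E; apply: lerD.
- by apply: le_trans (ler_norm _) _; rewrite normrM ler_wpM2l.
- by apply: le_trans (ler_norm _) _; rewrite normrM ler_wpM2l.
Qed.

(** * Faces of [F], and the strip cut out by two parallel sides *)

Lemma face_in_segment (R : realType) (F B : set 'rV[R]_2) x y t :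
  is_face F B -> B x -> B y -> 0 <= t <= 1 -> B ((1 - t) *: x + t *: y).
Proof.
move=> [_ cB _] Bx By /andP[t0 t1].
have t01 : Itv.spec (@Itv.num_sem R) (Itv.Real `[0%Z, 1%Z]) t.
  by rewrite /Itv.spec /Itv.num_sem /= num_real in_itv /= t0.
(* [convex_set] puts the weight [t] on its first point, hence the reversed order. *)
have := cB y x (Itv.mk t01) (mem_set By) (mem_set Bx).
by rewrite inE; congr (B _); rewrite addrC.
Qed.

(** Beyond [x] or [y], the nearer of these two points lies in the open segment from the new point to
    the other one, so the face property absorbs the new point; between them convexity suffices. *)
Lemma face_collinear (R : realType) (F B : set 'rV[R]_2) x y t :
  is_face F B -> B x -> B y -> F (x + t *: (y - x)) -> B (x + t *: (y - x)).
Proof.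
move=> fB Bx By Fz; have [BF _ exB] := fB.
have [t0|t0] := ltrP t 0.
  have [] // := exB _ y Fz (BF _ By); exists x; split=> //.
  have n0 : 1 - t != 0 by apply/eqP; lra.
  exists (- t / (1 - t)).
    rewrite /= divr_gt0 ?oppr_gt0 //=; last lra.
    by rewrite ltr_pdivrMr; lra.
  by apply/rowP => i; rewrite !mxE; field.
have [t1|t1] := ltrP 1 t.
  have [] // := exB x _ (BF _ Bx) Fz; exists y; split=> //.
  have n0 : t != 0 by apply/eqP; lra.
  exists (t^-1).
    by rewrite /= invr_gt0 (lt_trans ltr01 t1) /= invf_lt1 // (lt_trans ltr01 t1).
  by apply/rowP => i; rewrite !mxE; field.
have -> : x + t *: (y - x) = (1 - t) *: x + t *: y.
  by apply/rowP => i; rewrite !mxE; ring.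
by apply: (face_in_segment fB) => //; rewrite t0.
Qed.

Lemma polygon_convex (R : realType) (F : set 'rV[R]_2) x y t :
  unbounded_convex_polygon F -> F x -> F y -> 0 <= t <= 1 ->
  F ((1 - t) *: x + t *: y).
Proof.
move=> [[k [a [b [_ ->]]]] _ _] Fx Fy /andP[t0 t1] i _.
rewrite /closed_halfplane /= !dotp_linr.
have := Fx i I; have := Fy i I; rewrite /closed_halfplane /= => ? ?; nra.
Qed.

Lemma vertical_face (R : realType) (u : 'rV[R]_2) (F G : set 'rV[R]_2) x y c z :
  dotp u u = 1 -> is_face F G -> G x -> G y -> x != y ->
  dotp (perp u) x = c -> dotp (perp u) y = c ->
  F z -> dotp (perp u) z = c -> G z.
Proof.
move=> u1 fG Gx Gy xy Xx Xy Fz Xz.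
have dY : dotp u y - dotp u x != 0.
  rewrite subr_eq0; apply: contra xy => /eqP Yxy.
  by apply/eqP/(coord_inj u1); rewrite ?Xx ?Xy.
suff e : z = x + ((dotp u z - dotp u x) / (dotp u y - dotp u x)) *: (y - x).
  by rewrite e; apply: (face_collinear fG) => //; rewrite -e.
by apply: (coord_inj u1); rewrite !dotp_linr ?Xx ?Xy ?Xz; field.
Qed.

(** Were there points of [F] strictly on both sides of the line, the segment joining them would
    cross it in a point of [G], and the face property would pull both endpoints into [G], hence onto
    the line. *)
Lemma vertical_face_supports (R : realType) (u : 'rV[R]_2)
    (F G : set 'rV[R]_2) x y c :
  dotp u u = 1 -> unbounded_convex_polygon F ->
  is_face F G -> G x -> G y -> x != y ->
  G `<=` [set z | dotp (perp u) z = c] ->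
  (forall z, F z -> c <= dotp (perp u) z) \/
  (forall z, F z -> dotp (perp u) z <= c).
Proof.
move=> u1 pF fG Gx Gy xy Gc.
have [//|/existsNP[z1 /not_implyP[Fz1 /negP]]] :=
  pselect (forall z, F z -> c <= dotp (perp u) z); first by left.
rewrite -ltNge => lt1; right=> z2 Fz2; rewrite leNgt; apply/negP => lt2.
have d0 : dotp (perp u) z2 - dotp (perp u) z1 != 0 by apply/eqP; lra.
pose t := (c - dotp (perp u) z1) / (dotp (perp u) z2 - dotp (perp u) z1).
have t01 : 0 < t < 1.
  by rewrite /t divr_gt0 /= ?ltr_pdivrMr; lra.
have Fw : F ((1 - t) *: z1 + t *: z2).
  by apply: polygon_convex => //; case/andP: t01 => /ltW-> /ltW->.
have Gw : G ((1 - t) *: z1 + t *: z2).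
  apply: (vertical_face u1 fG Gx Gy xy (Gc _ Gx) (Gc _ Gy) Fw).
  by rewrite !dotp_linr /t; field.
have [_ _ /(_ z1 z2 Fz1 Fz2)[]] := fG.
  by exists ((1 - t) *: z1 + t *: z2); split=> //; exists t.
by move=> /Gc /= e; rewrite e ltxx in lt1.
Qed.

Lemma parallel_sides_strip (R : realType) (F G H : set 'rV[R]_2) :
  unbounded_convex_polygon F -> sides F G -> sides F H -> G <> H ->
  parallel G H ->
  exists (u : 'rV[R]_2) (g h : R),
    [/\ dotp u u = 1, g < h,
        forall x, F x -> g <= dotp (perp u) x <= h,
        exists2 x, F x & dotp (perp u) x = g
      & exists2 x, F x & dotp (perp u) x = h].
Proof.
move=> pF [fG [_ [x1 [y1 [Gx1 Gy1 xy1]]]]] [fH [_ [x2 [y2 [Hx2 Hy2 xy2]]]]] GH.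
move=> [v [v0 [p Gp] [q Hq]]].
have vv0 : 0 < dotp v v.
  rewrite dotp2E -!expr2 lt_neqAle addr_ge0 ?sqr_ge0 // andbT eq_sym.
  apply: contra v0; rewrite paddr_eq0 ?sqr_ge0 // !sqrf_eq0 => /andP[/eqP v0 /eqP v1].
  apply/eqP/rowP => i; rewrite mxE.
  by have {i} [->|->] : i = 0 \/ i = 1
    by case: i => [[|[|i]]] // Hi; [left|right]; exact/val_inj.
pose u := (Num.sqrt (dotp v v))^-1 *: v.
have s0 : 0 < Num.sqrt (dotp v v) by rewrite sqrtr_gt0.
have u1 : dotp u u = 1.
  rewrite dotpZr dotpC dotpZr mulrA -expr2 exprVn sqr_sqrtr ?ltW //.
  by rewrite mulVf // gt_eqF.
have uv : dotp (perp u) v = 0.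
  have -> : v = Num.sqrt (dotp v v) *: u by rewrite scalerA divff ?scale1r // gt_eqF.
  by rewrite dotpZr dotp_perp mulr0.
have Gc : G `<=` [set z | dotp (perp u) z = dotp (perp u) p].
  by move=> z /Gp[t _ <-]; rewrite /= !dotp_linr uv; ring.
have Hc : H `<=` [set z | dotp (perp u) z = dotp (perp u) q].
  by move=> z /Hq[t _ <-]; rewrite /= !dotp_linr uv; ring.
have [GF _ _] := fG; have [HF _ _] := fH.
(* On a common line each side would contain the other by [vertical_face], forcing [G = H]. *)
have Xpq : dotp (perp u) p != dotp (perp u) q.
  apply/eqP => e; apply: GH; apply/seteqP; split=> z zA.
  - exact: (vertical_face u1 fH Hx2 Hy2 xy2 (Hc _ Hx2) (Hc _ Hy2) (GF _ zA)
             (etrans (Gc _ zA) e)).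
  - exact: (vertical_face u1 fG Gx1 Gy1 xy1 (Gc _ Gx1) (Gc _ Gy1) (HF _ zA)
             (etrans (Hc _ zA) (esym e))).
have sG := vertical_face_supports u1 pF fG Gx1 Gy1 xy1 Gc.
have sH := vertical_face_supports u1 pF fH Hx2 Hy2 xy2 Hc.
have := Gc _ Gx1; have := Hc _ Hx2 => /= ex2 ex1.
have Fx1 := GF _ Gx1; have Fx2 := HF _ Hx2.
exists u; case: (ltgtP (dotp (perp u) p) (dotp (perp u) q)) Xpq => // lt_pq _.
- exists (dotp (perp u) p), (dotp (perp u) q).
  split=> //; [|by exists x1|by exists x2] => z Fz.
  (* Each side supports [F]; a point of the other side decides on which side of the line [F]
     lies. *)
  case: sG => [sG|/(_ _ Fx2)]; last by rewrite ex2 leNgt lt_pq.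
  case: sH => [/(_ _ Fx1)|sH]; first by rewrite ex1 leNgt lt_pq.
  by rewrite sG // sH.
- exists (dotp (perp u) q), (dotp (perp u) p).
  split=> //; [|by exists x2|by exists x1] => z Fz.
  case: sH => [sH|/(_ _ Fx1)]; last by rewrite ex1 leNgt lt_pq.
  case: sG => [/(_ _ Fx2)|sG]; first by rewrite ex2 leNgt lt_pq.
  by rewrite sG // sH.
Qed.

(** * Description of [F] as an epigraph over a strip *)

Lemma small_step (R : realType) (T : eqType) (s : seq T) (D E : T -> R) :
  (forall l, l \in s -> 0 < D l) ->
  exists e, 0 < e <= 1 /\
    forall l t, l \in s -> 0 <= t <= e -> 0 <= D l + t * E l.
Proof.
elim: s => [_|l s IH Ds]; first by exists 1; rewrite ltr01 lexx.
have [|e [/andP[e0 e1] He]] := IH.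
  by move=> l' l's; apply: Ds; rewrite inE l's orbT.
have Dl : 0 < D l by apply: Ds; rewrite mem_head.
(* If [t * (1 + |E l|) <= D l], then [D l + t * E l >= t >= 0]; the summand 1 keeps the denominator
   positive. *)
have El : 0 < D l / (1 + `|E l|) by rewrite divr_gt0 // ltr_pwDl.
exists (Num.min e (D l / (1 + `|E l|))); split.
  by rewrite lt_min e0 El /= ge_min e1.
move=> l' t; rewrite le_min inE => /orP[/eqP ->|l's] /and3P[t0 te tD]; last first.
  by apply: He; rewrite ?t0.
move: tD; rewrite ler_pdivlMr ?ltr_pwDl // => tD.
have : - `|E l| <= E l by rewrite lerNl -normrN ler_norm.
move=> ?; nra.
Qed.

(** An affine function is stored as the pair (slope, intercept), so that members of a list can be
    compared by [==]. *)
Definition aff (R : realType) (l : R * R) (x : R) : R := l.1 * x + l.2.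

(** Induction on the length: a member that is nowhere strictly the largest can be deleted, since a
    point where it alone violates the bound [y] would make it strictly the largest there. *)
Lemma irredundant_subfamily (R : realType) (g h : R) (s : seq (R * R)) :
  exists s' : seq (R * R),
    (forall x y, g <= x <= h -> (forall l, l \in s -> aff l x <= y) <->
                                (forall l, l \in s' -> aff l x <= y)) /\
    forall l, l \in s' -> exists2 x, g <= x <= h &
      forall l', l' \in s' -> l' != l -> aff l' x < aff l x.
Proof.
have [n] := ubnP (size s); elim: n s => // n IH s szs.
have [?|/existsNP[l /not_implyP[ls red]]] := pselect (forall l, l \in s ->
  exists2 x, g <= x <= h & forall l', l' \in s -> l' != l -> aff l' x < aff l x).
  by exists s.
have [|s' [ss' irr]] := IH [seq l' <- s | l' != l].
  rewrite ltnS in szs; rewrite size_filter; apply: leq_trans szs.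
  by rewrite -(count_predC (pred1 l) s) -[ltnLHS]add0n ltn_add2r -has_count has_pred1.
exists s'; split=> // x y xgh; rewrite -ss' //; split=> [sy l'|sy l' l's].
  by rewrite mem_filter => /andP[_]; exact: sy.
have [->|l'l] := eqVneq l' l; last by apply: sy; rewrite mem_filter l'l.
apply: contrapT => /negP; rewrite -ltNge => ly; apply: red; exists x => // l2 l2s l2l.
by apply: le_lt_trans ly; apply: sy; rewrite mem_filter l2l.
Qed.

Definition epigraph (R : realType) (u : 'rV[R]_2) (g h : R) (s : seq (R * R)) :
    set 'rV[R]_2 :=
  [set x | g <= dotp (perp u) x <= h /\
           forall l, l \in s -> aff l (dotp (perp u) x) <= dotp u x].

(** A normal with positive [u]-component bounds the ordinate from above, one with negative component
    from below; together with the strip they would make [F] bounded. *)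
Lemma strip_recession (R : realType) (u : 'rV[R]_2) (g h : R) k
    (a : 'I_k -> 'rV[R]_2) (b : 'I_k -> R) (F : set 'rV[R]_2) :
  dotp u u = 1 -> F = \bigcap_(i in [set: 'I_k]) closed_halfplane (a i) (b i) ->
  (forall x, F x -> g <= dotp (perp u) x <= h) -> ~ bounded_set F ->
  (forall i, dotp (a i) u <= 0) \/ (forall i, 0 <= dotp (a i) u).
Proof.
move=> u1 Fab strip unbF.
have [|/existsNP[i /negP]] := pselect (forall i, dotp (a i) u <= 0); first by left.
rewrite -ltNge => Bi; right=> j; rewrite leNgt; apply/negP => Bj; apply: unbF.
pose M := `|g| + `|h|.
pose N c := (`|b c| + `|dotp (a c) (perp u)| * M) / `|dotp (a c) u|.
have N0 c : 0 <= N c by rewrite divr_ge0 // addr_ge0 // mulr_ge0 // addr_ge0.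
apply: (bounded_coord (M := M + N i + N j) u1) => x Fx.
have XM : `|dotp (perp u) x| <= M.
  have /andP[gX Xh] := strip x Fx; rewrite /M ler_norml.
  have := ler_norm h; have := ler_norm (- g); rewrite normrN.
  have := normr_ge0 g; have := normr_ge0 h.
  by move=> *; apply/andP; split; lra.
have key c : dotp (a c) u * dotp u x <= `|b c| + `|dotp (a c) (perp u)| * M.
  have := Fx; rewrite Fab => /(_ c I); rewrite /closed_halfplane /= (dotp_coord _ _ u1).
  have h1 : `|dotp (a c) (perp u) * dotp (perp u) x| <= `|dotp (a c) (perp u)| * M.
    by rewrite normrM ler_wpM2l.
  have := ler_norm (b c).
  by move: h1; rewrite ler_norml => /andP[]; lra.
have Yi : dotp u x <= N i.
  by rewrite /N (gtr0_norm Bi) ler_pdivlMr // mulrC; exact: key.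
have Yj : - dotp u x <= N j.
  rewrite /N (ltr0_norm Bj) ler_pdivlMr ?oppr_gt0 //.
  by rewrite mulrNN mulrC; exact: key.
have M0 : 0 <= M by rewrite addr_ge0.
have := N0 i; have := N0 j => ? ?; split; first lra.
by rewrite ler_norml; apply/andP; split; lra.
Qed.

(** Dividing by a negative [u]-component turns a halfplane into a lower bound on the ordinate. A
    vertical halfplane contains a point of abscissa [g] and one of abscissa [h], hence the whole
    strip. *)
Lemma strip_epigraph (R : realType) (u : 'rV[R]_2) (g h : R) k
    (a : 'I_k -> 'rV[R]_2) (b : 'I_k -> R) (F : set 'rV[R]_2) :
  dotp u u = 1 -> F = \bigcap_(i in [set: 'I_k]) closed_halfplane (a i) (b i) ->
  (forall x, F x -> g <= dotp (perp u) x <= h) ->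
  (exists2 x, F x & dotp (perp u) x = g) ->
  (exists2 x, F x & dotp (perp u) x = h) ->
  (forall i, dotp (a i) u <= 0) ->
  exists s, F = epigraph u g h s.
Proof.
move=> u1 Fab strip [xg Fxg Xg] [xh Fxh Xh] Bneg.
have FE x : F x <-> forall i,
    dotp (a i) (perp u) * dotp (perp u) x + dotp (a i) u * dotp u x <= b i.
  rewrite Fab; split=> [Fx i|Fx i _].
    by rewrite -dotp_coord //; exact: Fx.
  by rewrite /closed_halfplane /= (dotp_coord _ _ u1); exact: Fx.
pose f i := (- dotp (a i) (perp u) / dotp (a i) u, b i / dotp (a i) u).
have affE i x y : dotp (a i) u < 0 -> (aff (f i) x <= y) =
    (dotp (a i) (perp u) * x + dotp (a i) u * y <= b i).
  move=> Bi; rewrite /aff /= mulrAC -mulrDl ler_ndivrMr //.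
  by apply/idP/idP; lra.
exists [seq f i | i <- enum 'I_k & dotp (a i) u < 0]; apply/seteqP; split=> x.
  move=> Fx; split; first exact: strip.
  move=> _ /mapP[i + ->]; rewrite mem_filter => /andP[Bi _].
  by rewrite affE //; exact: (FE x).1.
move=> [/andP[gX Xh'] sx]; apply/FE => i.
have := Bneg i; rewrite le_eqVlt => /orP[/eqP B0|Bi]; last first.
  by rewrite -affE //; apply: sx; apply/mapP; exists i; rewrite // mem_filter Bi mem_enum.
have := (FE xg).1 Fxg i; have := (FE xh).1 Fxh i.
rewrite B0 !mul0r !addr0 Xg Xh => Ah Ag.
have [A0|A0] := lerP 0 (dotp (a i) (perp u)).
  by apply: le_trans Ah; rewrite ler_wpM2l.
by apply: le_trans Ag; rewrite ler_nM2l.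
Qed.

(** * Bounded sides of an epigraph *)

Definition irredundant (R : realType) (g h : R) (s : seq (R * R)) :=
  forall l, l \in s -> exists2 x, g <= x <= h &
    forall l', l' \in s -> l' != l -> aff l' x < aff l x.

Definition edge (R : realType) (u : 'rV[R]_2) (g h : R) s (l : R * R) :
    set 'rV[R]_2 :=
  [set x | epigraph u g h s x /\ dotp u x = aff l (dotp (perp u) x)].

(** Where [l] is strictly the largest, its edge contains a point strictly above the graph of
    [l']. *)
Lemma edge_inj (R : realType) (u : 'rV[R]_2) (g h : R) s l l' :
  dotp u u = 1 -> irredundant g h s -> l \in s -> l' \in s ->
  edge u g h s l = edge u g h s l' -> l = l'.
Proof.
move=> u1 irr ls l's e; have [//|ll'] := eqVneq l l'.
have [x xgh lt_x] := irr l ls.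
have : edge u g h s l (frame_point u x (aff l x)).
  split; rewrite ?frame_pointX ?frame_pointY //; split; rewrite ?frame_pointX ?frame_pointY // => l2 l2s.
  by have [->//|l2l] := eqVneq l2 l; exact: ltW (lt_x _ _ _).
rewrite e => -[_]; rewrite frame_pointX // frame_pointY // => e'.
by have := lt_x l' l's; rewrite eq_sym ll' -e' ltxx => /(_ isT).
Qed.

(** The edge is the zero set of [dotp u x - aff l (dotp (perp u) x)], an affine function that is
    nonnegative on the epigraph. *)
Lemma edge_face (R : realType) (u : 'rV[R]_2) (g h : R) s l :
  l \in s -> is_face (epigraph u g h s) (edge u g h s l).
Proof.
move=> ls; split.
- by move=> x [].
- move=> y x t; rewrite !inE => -[[/andP[gy yh] sy] ey] [[/andP[gx xh] sx] ex].
  have t0 : 0 <= t%:num by [].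
  have t1 : t%:num <= 1 by [].
  pose w : 'rV[R]_2 := t%:num *: (y : 'rV[R]_2) + (1 - t%:num) *: (x : 'rV[R]_2).
  change (edge u g h s l w).
  have wE c : dotp c w = t%:num * dotp c y + (1 - t%:num) * dotp c x.
    by rewrite /w dotpDr !dotpZr.
  split; last by move: ex ey; rewrite !wE /aff => -> ->; ring.
  split; first by rewrite !wE; apply/andP; split; nra.
  move=> l2 l2s; rewrite !wE; have := sx _ l2s; have := sy _ l2s; rewrite /aff => ? ?; nra.
- move=> x y Fx Fy [_ [[t /andP[t0 t1] <-] [_ ]]].
  rewrite /aff !dotp_linr => e.
  have [_ /(_ _ ls)] := Fx; have [_ /(_ _ ls)] := Fy; rewrite /aff => hy hx.
  by split; split=> //; rewrite /aff; apply/eqP; rewrite eq_le; apply/andP; split=> //; nra.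
Qed.

Lemma edge_side (R : realType) (u : 'rV[R]_2) (g h : R) s l :
  dotp u u = 1 -> g < h -> irredundant g h s -> l \in s ->
  sides (epigraph u g h s) (edge u g h s l).
Proof.
move=> u1 gh irr ls; split; first exact: edge_face.
split.
  exists (frame_point u 0 l.2), (frame_point u 1 l.1); split.
    apply/eqP => e; have := frame_pointX 1 l.1 u1; rewrite e !dotp2E !mxE.
    by rewrite !mulr0 addr0 => /esym/eqP; rewrite oner_eq0.
  move=> x [_ ex]; exists (dotp (perp u) x) => //.
  apply: (coord_inj u1); rewrite !dotp_linr ?(dotpC u (perp u)) ?dotp_perp2.
    by rewrite dotp_perp u1; ring.
  by rewrite dotp_perp u1 ex /aff; ring.
have [x0 /andP[gx xh] lt_x] := irr l ls.
(* Moving from [x0] towards an end [d] of the strip other than [x0] stays inside the strip; a short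
   move keeps [l] on top and yields a second point of the edge. *)
have [d /andP[gd dh] dx] : exists2 d, g <= d <= h & d != x0.
  have [->|?] := eqVneq x0 g; first by exists h; rewrite ?(ltW gh) ?lexx ?gt_eqF.
  by exists g; rewrite ?(ltW gh) ?lexx // eq_sym.
have [|e [/andP[e0 e1] He]] := @small_step R _ [seq l' <- s | l' != l]
  (fun l' => aff l x0 - aff l' x0) (fun l' => (l.1 - l'.1) * (d - x0)).
  by move=> l'; rewrite mem_filter subr_gt0 => /andP[? ?]; apply: lt_x.
pose pt t := x0 + t * (d - x0).
have E t : 0 <= t <= e -> edge u g h s l (frame_point u (pt t) (aff l (pt t))).
  move=> /andP[t0 te]; split; rewrite ?frame_pointX ?frame_pointY //; split; rewrite ?frame_pointX ?frame_pointY //.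
    by apply/andP; rewrite /pt; split; nra.
  move=> l2 l2s; have [->//|l2l] := eqVneq l2 l.
  have := He l2 t; rewrite mem_filter l2l l2s t0 te /aff /pt => /(_ isT isT).
  lra.
exists (frame_point u (pt 0) (aff l (pt 0))), (frame_point u (pt e) (aff l (pt e))); split.
- by apply: E; rewrite lexx ltW.
- by apply: E; rewrite lexx ltW.
- apply/eqP => /(congr1 (dotp (perp u))); rewrite !frame_pointX // /pt mul0r addr0.
  move/eqP; rewrite eq_sym -subr_eq0 addrAC subrr add0r mulf_eq0 subr_eq0.
  by rewrite (negbTE dx) orbF gt_eqF.
Qed.

Lemma edge_bounded (R : realType) (u : 'rV[R]_2) (g h : R) s l :
  dotp u u = 1 -> bounded_set (edge u g h s l).
Proof.
move=> u1; pose M := `|g| + `|h|.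
apply: (bounded_coord (M := M + (`|l.1| * M + `|l.2|)) u1).
move=> x [[/andP[gX Xh] _] ->].
have XM : `|dotp (perp u) x| <= M.
  rewrite /M ler_norml.
  have := ler_norm h; have := ler_norm (- g); rewrite normrN.
  have := normr_ge0 g; have := normr_ge0 h.
  by move=> *; apply/andP; split; lra.
have M0 : 0 <= M by rewrite addr_ge0.
have lM : `|aff l (dotp (perp u) x)| <= `|l.1| * M + `|l.2|.
  apply: le_trans (ler_normD _ _) _; rewrite normrM lerD2r.
  by rewrite ler_wpM2l.
have : 0 <= `|l.1| * M + `|l.2| by rewrite addr_ge0 // mulr_ge0.
by split; lra.
Qed.

(** The midpoint of two points of [B] must lie on some graph, for otherwise [B] contains an upward
    ray. Both points then lie on that graph, and [B] is everything of the epigraph on their line. *)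
Lemma bounded_side_edge (R : realType) (u : 'rV[R]_2) (g h : R) s B :
  dotp u u = 1 -> sides (epigraph u g h s) B -> bounded_set B ->
  exists2 l, l \in s & B = edge u g h s l.
Proof.
move=> u1 [fB [[p [v [v0 Bline]]] [x [y [Bx By xy]]]]] bB.
have [BF _ exB] := fB.
have [m mE] : exists m, m = (1 - 2^-1) *: x + 2^-1 *: y by eexists.
have h01 : 0 < (2^-1 : R) < 1 by apply/andP; split; lra.
have Bm : B m by rewrite mE; apply: (face_in_segment fB) => //; case/andP: h01 => /ltW -> /ltW ->.
have [[mgh sm] [[xgh sx] [ygh sy]]] := (BF _ Bm, (BF _ Bx, BF _ By)).
have [l ls lm] : exists2 l, l \in s & dotp u m = aff l (dotp (perp u) m).
  apply: contrapT => nl.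
  have [|e [/andP[e0 e1] He]] := @small_step R _ s
     (fun l => dotp u m - aff l (dotp (perp u) m)) (fun=> -1).
    move=> l ls; rewrite subr_gt0 lt_neqAle sm // andbT.
    by apply/eqP => e; apply: nl; exists l.
  (* [m - e *: u] lies in the polygon and so do all [m + t *: u], hence the whole
     upward ray from [m] is in the bounded face [B]. *)
  have Fdown : epigraph u g h s (m - e *: u).
    split; rewrite !dotpDr !dotpNr !dotpZr dotp_perp ?u1 mulr0 subr0 // => l ls.
    by have := He l e ls; rewrite lexx ltW // => /(_ isT); lra.
  have Bup t : 0 < t -> B (m + t *: u).
    move=> t0; have Fup : epigraph u g h s (m + t *: u).
      split; rewrite !dotpDr !dotpZr dotp_perp ?u1 mulr0 addr0 // => l ls.
      by have := sm l ls; lra.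
    have [] // := exB _ _ Fdown Fup; exists m; split=> //.
    exists (e / (e + t)).
      rewrite /= divr_gt0 /= ?addr_gt0 //.
      by rewrite ltr_pdivrMr ?addr_gt0 //; lra.
    have n0 : e + t != 0 by rewrite gt_eqF ?addr_gt0.
    by apply/rowP => i; rewrite !mxE; field.
  have [M HM] := bounded_dotp u bB.
  have M0 : 0 < 1 + `|M - dotp u m| by rewrite ltr_pwDl.
  have := HM _ (Bup _ M0); rewrite dotpDr dotpZr u1.
  by have := ler_norm (M - dotp u m); lra.
have [lx ly] : dotp u x = aff l (dotp (perp u) x) /\ dotp u y = aff l (dotp (perp u) y).
  move: lm (sx _ ls) (sy _ ls); rewrite mE /aff !dotp_linr => lm hx hy.
  by split; lra.
have dX : dotp (perp u) y - dotp (perp u) x != 0.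
  rewrite subr_eq0; apply: contra xy => /eqP e.
  by apply/eqP/(coord_inj u1); rewrite ?lx ?ly e.
exists l => //; apply/seteqP; split=> z.
  move=> Bz; split; first exact: BF.
  have [[tx _ ex] [[ty _ ey] [tz _ ez]]] := (Bline _ Bx, (Bline _ By, Bline _ Bz)).
  have txy : ty - tx != 0.
    by rewrite subr_eq0; apply: contra xy => /eqP e; rewrite -ex -ey e.
  have -> : z = x + ((tz - tx) / (ty - tx)) *: (y - x).
    by rewrite -ex -ey -ez; apply/rowP => i; rewrite !mxE; field.
  by move: lx ly; rewrite /aff !dotp_linr => -> ->; ring.
move=> [Fz lz].
suff e : z = x + ((dotp (perp u) z - dotp (perp u) x) /
                  (dotp (perp u) y - dotp (perp u) x)) *: (y - x).
  by rewrite e; apply: (face_collinear fB) => //; rewrite -e.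
by apply: (coord_inj u1); rewrite !dotp_linr ?lx ?ly ?lz /aff; field.
Qed.

(** * Voronoi cells and the four sites *)

Lemma voronoi_cellP (R : realType) n (T S : {fset 'rV[R]_n}) x :
  voronoi_cell T S x <->
  forall s t, s \in S -> t \in (T `\` S)%fset ->
    dotp (x - s) (x - s) <= dotp (x - t) (x - t).
Proof.
have dotp_ge0 (y : 'rV[R]_n) : 0 <= dotp y y.
  by rewrite sumr_ge0 // => i _; rewrite -expr2 sqr_ge0.
split=> [le_xT s t sS tT|le_xT].
  rewrite -ler_sqrt // -lee_fin.
  apply: (le_trans _ (le_trans le_xT _)).
  - exact: (le_bigmax_seq _ s xpredT (fun s => (enorm (x - s))%:E)).
  - exact: (ge_bigmin_seq _ t xpredT (fun t => (enorm (x - t))%:E)).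
(* The defaults [-oo] and [+oo] satisfy every bound required here, so only pairs of sites remain. *)
rewrite /voronoi_cell /= big_seq; apply: bigmax_le; first exact: leNye.
move=> s sS; rewrite big_seq; apply: le_bigmin; first exact: leey.
by move=> t tT; rewrite lee_fin ler_sqrt //; exact: le_xT.
Qed.

(* With slopes [p1 < p2] and breakpoint abscissa [m], [s1], [t1], [t2] lie on a
   horizontal line: [t1] and [t2] are the reflections of [s1] in the two vertical
   sides, and the abscissa of [s1] makes them equidistant from the middle vertex.
   The common ordinate [e] is then chosen so that the reflections of [t1] in the
   first and of [t2] in the second bounded side coincide; this point is [s2]. *)
Lemma epigraph2_voronoi (R : realType) (u : 'rV[R]_2) (g h p1 c1 p2 c2 m : R) :
  dotp u u = 1 -> g < m < h -> p1 < p2 -> p1 * m + c1 = p2 * m + c2 ->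
  exists S T : {fset 'rV[R]_2},
    [/\ (S `<=` T)%fset, #|` S|%fset = 2%N, #|` T|%fset = 4%N
      & voronoi_cell T S = epigraph u g h [:: (p1, c1); (p2, c2)]].
Proof.
move=> u1 /andP[gm mh] p12 em.
(* [s2 - t1] and [s2 - t2] must be [r] times the normals [(- p1, 1)] and [(- p2, 1)]; as [t2] is
   [2 * w] to the right of [t1], this forces [r * (p2 - p1) = 2 * w]. *)
pose w := h - g; pose r := 2 * w / (p2 - p1).
have w0 : 0 < w by rewrite subr_gt0 (lt_trans gm).
have r0 : 0 < r by rewrite divr_gt0 ?mulr_gt0 // subr_gt0.
have rE : r * (p2 - p1) = 2 * w by rewrite /r divfK // gt_eqF // subr_gt0.
(* This ordinate puts the midpoint of [t1] and [s2] on the graph of [(p1, c1)]. *)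
pose e := p1 * m + c1 - r / 2 - p1 * w - r * p1 ^+ 2 / 2.
have [s1 s1E] : exists s1, s1 = frame_point u (g + h - m) e by eexists.
have [s2 s2E] : exists s2, s2 = frame_point u (m - w - r * p1) (e + r) by eexists.
have [t1 t1E] : exists t1, t1 = frame_point u (m - w) e by eexists.
have [t2 t2E] : exists t2, t2 = frame_point u (m + w) e by eexists.
have neqX y z : dotp (perp u) y != dotp (perp u) z -> y != z.
  by apply: contra => /eqP ->.
have neqY y z : dotp u y != dotp u z -> y != z by apply: contra => /eqP ->.
have n1 : s1 != s2.
  by apply: neqY; rewrite s1E s2E !frame_pointY //; apply/eqP; lra.
have n2 : s1 != t1.
  by apply: neqX; rewrite s1E t1E !frame_pointX //; apply/eqP; rewrite /w; lra.
have n3 : s1 != t2.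
  by apply: neqX; rewrite s1E t2E !frame_pointX //; apply/eqP; rewrite /w; lra.
have n4 : s2 != t1.
  by apply: neqY; rewrite s2E t1E !frame_pointY //; apply/eqP; lra.
have n5 : s2 != t2.
  by apply: neqY; rewrite s2E t2E !frame_pointY //; apply/eqP; lra.
have n6 : t1 != t2.
  by apply: neqX; rewrite t1E t2E !frame_pointX //; apply/eqP; lra.
have dE x a b : dotp (x - frame_point u a b) (x - frame_point u a b) =
    (dotp (perp u) x - a) ^+ 2 + (dotp u x - b) ^+ 2.
  rewrite (dotpxx_coord _ u1) !(dotpDr _ x) !(dotpNr _ (frame_point _ _ _)).
  by rewrite frame_pointX // frame_pointY.
pose d (x z : 'rV[R]_2) := dotp (x - z) (x - z).
(* The four differences of squared distances are positive multiples of the four affine forms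
   defining the epigraph. *)
have d11 x : d x t1 - d x s1 = 4 * (h - m) * (dotp (perp u) x - g).
  by rewrite /d t1E s1E !dE /w; ring.
have d12 x : d x t2 - d x s1 = 4 * (m - g) * (h - dotp (perp u) x).
  by rewrite /d t2E s1E !dE /w; ring.
have d21 x : d x t1 - d x s2 = 2 * r * (dotp u x - aff (p1, c1) (dotp (perp u) x)).
  by rewrite /d t1E s2E !dE /aff /= /e; field.
have d22 x : d x t2 - d x s2 = 2 * r * (dotp u x - aff (p2, c2) (dotp (perp u) x)).
  (* Crossing at [m] eliminates [c2] and the choice of [r] eliminates [w], leaving a field
     identity. *)
  have -> : c2 = p1 * m + c1 - p2 * m by lra.
  have wE : w = r * (p2 - p1) / 2 by lra.
  by rewrite /d t2E s2E !dE /aff /= /e wE; field.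
have sign (a b c y : R) : 0 < c -> b - a = c * y -> (a <= b) = (0 <= y).
  by move=> c0 ab; rewrite -subr_ge0 ab pmulr_rge0.
have hm : 0 < 4 * (h - m) by rewrite mulr_gt0 // subr_gt0.
have mg : 0 < 4 * (m - g) by rewrite mulr_gt0 // subr_gt0.
have rr : 0 < 2 * r by rewrite mulr_gt0.
have i11 x := sign _ _ _ _ hm (d11 x).
have i12 x := sign _ _ _ _ mg (d12 x).
have i21 x := sign _ _ _ _ rr (d21 x).
have i22 x := sign _ _ _ _ rr (d22 x).
pose T := (s1 |` (s2 |` [fset t1; t2]))%fset.
have TS z : (z \in T `\` [fset s1; s2])%fset = (z == t1) || (z == t2).
  rewrite !inE.
  have [->|zt1] := eqVneq z t1; first by rewrite !(eq_sym t1) (negbTE n2) (negbTE n4).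
  have [->|zt2] := eqVneq z t2; first by rewrite !(eq_sym t2) (negbTE n3) (negbTE n5) orbT.
  by rewrite !orbF; case: (_ || _).
exists [fset s1; s2]%fset, T; split.
- by apply/fsubsetP => z; rewrite !inE => /orP[] ->; rewrite ?orbT.
- by rewrite cardfs2 n1.
- by rewrite !cardfsU1 cardfs1 !inE !negb_or n1 n2 n3 n4 n5 n6.
apply/seteqP; split=> x.
- move=> /voronoi_cellP V.
  have in1 : s1 \in [fset s1; s2]%fset by rewrite !inE eqxx.
  have in2 : s2 \in [fset s1; s2]%fset by rewrite !inE eqxx orbT.
  have ot1 : t1 \in (T `\` [fset s1; s2])%fset by rewrite TS eqxx.
  have ot2 : t2 \in (T `\` [fset s1; s2])%fset by rewrite TS eqxx orbT.
  have := V _ _ in1 ot1; have := V _ _ in1 ot2.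
  have := V _ _ in2 ot1; have := V _ _ in2 ot2.
  rewrite i11 i12 i21 i22 !subr_ge0 => l2 l1 Xh gX.
  split; first by rewrite gX.
  by move=> l; rewrite !inE => /orP[] /eqP ->.
- move=> [/andP[gX Xh] lx]; apply/voronoi_cellP => s t.
  have l1 := lx (p1, c1) (mem_head _ _).
  have l2 : aff (p2, c2) (dotp (perp u) x) <= dotp u x by apply: lx; rewrite !inE eqxx orbT.
  rewrite TS !inE => /orP[] /eqP -> /orP[] /eqP ->.
  - by rewrite i11 subr_ge0.
  - by rewrite i12 subr_ge0.
  - by rewrite i21 subr_ge0.
  - by rewrite i22 subr_ge0.
Qed.

(** * From two bounded sides to the Voronoi cell *)

Lemma card2P (T : Type) (A : set T) :
  (A #= `I_2)%card -> exists x y, x <> y /\ A = [set x; y].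
Proof.
move=> /eq_cardSP[x Ax /eq_cardSP[y [Ay yx]]]; rewrite II0 card_eq0 => /eqP A0.
exists x, y; split; first by move=> xy; exact: yx.
apply/seteqP; split=> [z Az|z [] -> //].
apply: contrapT => nz; suff : set0 z by [].
by rewrite -A0; split; [split=> // zx; apply: nz; left|move=> zy; apply: nz; right].
Qed.

Lemma epigraph_voronoi (R : realType) (u : 'rV[R]_2) (g h : R) s :
  dotp u u = 1 -> g < h ->
  (sides (epigraph u g h s) `&` bounded_set #= `I_2)%card ->
  exists S T : {fset 'rV[R]_2},
    [/\ (S `<=` T)%fset, #|` S|%fset = 2%N, #|` T|%fset = 4%N
      & voronoi_cell T S = epigraph u g h s].
Proof.
move=> u1 gh; have [s' [ss' irr]] := irredundant_subfamily g h s.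
have -> : epigraph u g h s = epigraph u g h s'.
  by apply/seteqP; split=> x [xgh /(ss' _ _ xgh) sx].
move=> /card2P[B1 [B2 [B12 sB]]].
have [sB1 bB1] : (sides (epigraph u g h s') `&` bounded_set) B1 by rewrite sB; left.
have [sB2 bB2] : (sides (epigraph u g h s') `&` bounded_set) B2 by rewrite sB; right.
have [l1 l1s e1] := bounded_side_edge u1 sB1 bB1.
have [l2 l2s e2] := bounded_side_edge u1 sB2 bB2.
have l12 : l1 != l2 by apply/eqP => e; apply: B12; rewrite e1 e2 e.
(* Every member of [s'] gives a bounded side, so its edge is [B1] or [B2]. *)
have s'E l : l \in s' -> l = l1 \/ l = l2.
  move=> ls.
  have : (sides (epigraph u g h s') `&` bounded_set) (edge u g h s' l).
    by split; [exact: edge_side|exact: edge_bounded].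
  rewrite sB e1 e2 => -[] /(edge_inj u1 irr ls) e.
  - by left; exact: e.
  - by right; exact: e.
have [x1 /andP[gx1 x1h] /(_ l2 l2s)] := irr l1 l1s; rewrite eq_sym => /(_ l12) lt1.
have [x2 /andP[gx2 x2h] /(_ l1 l1s l12) lt2] := irr l2 l2s.
have epi2 la lb : (forall l, l \in s' <-> l = la \/ l = lb) ->
    epigraph u g h s' = epigraph u g h [:: la; lb].
  move=> s'ab; apply/seteqP; split=> x [xgh sx]; split=> // l.
    by rewrite !inE => /orP[] /eqP ->; apply: sx; apply/s'ab; [left|right].
  by move=> /s'ab l_ab; apply: sx; rewrite !inE; case: l_ab => ->; rewrite eqxx ?orbT.
have e12 : epigraph u g h s' = epigraph u g h [:: l1; l2].
  by apply: epi2 => l; split=> [/s'E|[] ->].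
have e21 : epigraph u g h s' = epigraph u g h [:: l2; l1].
  by apply: epi2 => l; split=> [/s'E[]|[] ->]; auto.
clear - u1 gh e12 e21 lt1 lt2 gx1 x1h gx2 x2h.
case: l1 l2 e12 e21 lt1 lt2 => [p1 c1] [p2 c2] e12 e21; rewrite /aff /= => lt1 lt2.
pose m := (c2 - c1) / (p1 - p2).
(* The smaller slope comes first. Each function wins strictly at one of [x1], [x2], so the crossing
   [m] is strictly between these points, and equal slopes are impossible. *)
case: (ltgtP p1 p2) => p12.
- have em : m * (p1 - p2) = c2 - c1 by rewrite divfK // lt_eqF // subr_lt0.
  rewrite e12; apply: (epigraph2_voronoi (m := m)) => //; last lra.
  by apply/andP; split; nra.
- have em : m * (p1 - p2) = c2 - c1 by rewrite divfK // gt_eqF // subr_gt0.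
  rewrite e21; apply: (epigraph2_voronoi (m := m)) => //; last lra.
  by apply/andP; split; nra.
- by subst p2; lra.
Qed.

Theorem proposition3p11 (R : realType) (F : set 'rV[R]_2)
  (hF : unbounded_convex_quadrilateral F)
  (hpar : exists G H : set 'rV[R]_2,
      [/\ sides F G, sides F H, G <> H & parallel G H]) :
  exists S T : {fset 'rV[R]_2},
    [/\ (S `<=` T)%fset, #|` S|%fset = 2%N, #|` T|%fset = 4%N
      & voronoi_cell T S = F].
Proof.
have [pF _ _ [cardB _] _] := hF.
have [G [H [sG sH GH par]]] := hpar.
have [u [g [h [u1 gh strip Fg Fh]]]] := parallel_sides_strip pF sG sH GH par.
have [[k [a [b [_ Fab]]]] _ unbF] := pF.
have [neg|pos] := strip_recession u1 Fab strip unbF.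
  have [s Fs] := strip_epigraph u1 Fab strip Fg Fh neg.
  by rewrite Fs in cardB *; exact: (epigraph_voronoi u1 gh).
(* Here [F] opens towards [- u]. Replacing [u] by [- u] also negates the abscissa, so the strip
   becomes [[- h, - g]]. *)
have nu1 : dotp (- u) (- u) = 1 by rewrite dotpNr dotpC dotpNr opprK.
have XN x : dotp (perp (- u)) x = - dotp (perp u) x.
  by rewrite perpN dotpC dotpNr dotpC.
have [||||s Fs] := strip_epigraph (g := - h) (h := - g) nu1 Fab.
- by move=> x /strip; rewrite XN !lerN2 andbC.
- by have [x Fx Xx] := Fh; exists x; rewrite // XN Xx.
- by have [x Fx Xx] := Fg; exists x; rewrite // XN Xx.
- by move=> i; rewrite dotpNr oppr_le0.
by rewrite Fs in cardB *; apply: (epigraph_voronoi nu1); rewrite // ltrN2.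
Qed.
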